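(* Let $n$ be a positive integer and let $q \equiv 1 \pmod n$ be a prime power. Let $\zeta_n$ be a primitive $n$-th root of unity in $\mathbb{F}_q^{*}$ and let $\chi_n \in \widehat{\mathbb{F}_q^{*}}$ be a character of order $n$. Then for all $m\ge 1$, all $A_1, \dots, A_m, B_1, \dots, B_m \in \widehat{\mathbb{F}_q^{*}}$ and all $\lambda\in\mathbb{F}_q$, $$\sum_{l=0}^{n-1} {}_{m}F_{m}\left( \begin{array}{cccc} A_1^n, & A_2^n, & \dots, & A_m^n \\ B_1^n, & B_2^n, & \dots, & B_m^n \end{array} \Big| \; \zeta_n^l \lambda \right)_{q} = {}_{nm}F_{nm}\left( \begin{array}{c} A_i \chi_n^l : 1 \leq i \leq m,\ 0 \leq l \leq n-1 \\ B_i \chi_n^l : 1 \leq i \leq m,\ 0 \leq l \leq n-1 \end{array} \Big| \; \lambda^n \right)_{q}.$$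
   Context: $\mathbb{F}_q$ is the finite field with $q$ elements and $\widehat{\mathbb{F}_q^*}$ the group of (complex) multiplicative characters of $\mathbb{F}_q^*$; every $\chi\in\widehat{\mathbb{F}_q^*}$, including the trivial character $\varepsilon$, is extended to $\mathbb{F}_q$ by $\chi(0):=0$, and $\overline{\chi}$ denotes the inverse of $\chi$. Fix a non-trivial additive character $\theta$ of $\mathbb{F}_q$ and define the Gauss sum $g(\chi):=\sum_{x\in\mathbb{F}_q}\chi(x)\theta(x)$. For $A_1,\dots,A_m,B_1,\dots,B_m\in\widehat{\mathbb{F}_q^*}$ and $\lambda\in\mathbb{F}_q$, the finite field hypergeometric function is $${}_{m}F_{m}\left( \begin{array}{cccc} A_1, & A_2, & \dots, & A_m \\ B_1, & B_2, & \dots, & B_m \end{array} \Big| \; \lambda \right)_{q} := \frac{-1}{q-1} \sum_{\chi \in \widehat{\mathbb{F}_q^{*}}} \prod_{i=1}^{m} \frac{g(A_i \chi)}{g(A_i)} \frac{g(\overline{B_i \chi})}{g(\overline{B_i})}\, \chi(-1)^{m} \chi(\lambda).$$ *)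

(* Defs.v *)
From mathcomp Require Export all_boot all_order all_fingroup all_algebra.
From mathcomp Require Export all_solvable all_field all_character.

Set Implicit Arguments.
Unset Strict Implicit.
Unset Printing Implicit Defensive.

Import GroupScope GRing.Theory.
Local Open Scope ring_scope.

(* Class functions on the unit group F^*; the multiplicative characters of F
   are its [linear_char]s.  Their values are roots of unity, hence lie in
   [algC], as do all Gauss sums and hypergeometric values below. *)
Notation mulCF F := 'CF([set: {unit F}]) (only parsing).

(* The canonical finGroupType structure on F itself is the additive one, so
   an additive character of F is a [linear_char] in [addCF F]. *)
Notation addCF F := 'CF([set: F]) (only parsing).

(* chi extended to F by chi(0) := 0, for every chi, the trivial one included:
   0 is the only element on which [insub] fails. *)
Definition char_ext (F : finFieldType) (chi : mulCF F) (x : F) : algC :=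
  if insub x is Some u then chi u else 0.

Definition gauss_sum (F : finFieldType) (theta : addCF F) (chi : mulCF F) :
    algC :=
  \sum_(x : F) char_ext chi x * theta x.

(* mFm with m = #|I|.  The value does not depend on the order of the upper nor
   of the lower parameters, so they are indexed by an arbitrary finite type.
   The inverse is that of the ring 'CF(F^* ); on linear characters it is the
   group inverse of the dual of F^*. *)
Definition hypF (F : finFieldType) (theta : addCF F) (I : finType)
    (A B : I -> mulCF F) (lambda : F) : algC :=
  -1 / (#|F|%:R - 1) *
  \sum_(j : Iirr [set: {unit F}] | 'chi_j \is a linear_char)
     (\prod_(i : I)
        (gauss_sum theta (A i * 'chi_j) / gauss_sum theta (A i) *
         (gauss_sum theta ((B i * 'chi_j)^-1) / gauss_sum theta ((B i)^-1)))) *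
     char_ext 'chi_j (-1) ^+ #|I| * char_ext 'chi_j lambda.

(* Main.v *)
Require Import Defs.
From HB Require Import structures.

Set Implicit Arguments.
Unset Strict Implicit.
Unset Printing Implicit Defensive.

Import GRing.Theory.
Local Open Scope ring_scope.

(* The theorem reduces to the Hasse-Davenport product formula
     prod_l g(X eta^l) = X(D)^n g(X^n) C,   D = (-1)^(n+1) / n,
   in which C depends on neither X nor eta: the values at D coming from the
   upper and the lower parameters cancel, and sum_l chi(zeta^l) counts the n-th
   roots of the character chi.

   For the product formula, give a polynomial g = prod_i (1 - a_i T) over F with
   nonzero a_i the weight X(prod_i a_i)^n theta(sum_i a_i^n), and let W_k be the
   total weight in degree k. The logarithmic derivative of sum_k W_k T^k has as
   coefficients character sums over the fields with q^r elements, and the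
   substitution t = x^n turns them into the sum over l of the same coefficients
   for the weights (X eta^l)(prod_i a_i) theta(sum_i a_i), whose generating
   function is 1 + g(X eta^l) T. Hence W_n = prod_l g(X eta^l). On the other hand
   sum_i a_i^n is, in degree n, an affine function of slope -n of the leading
   coefficient of g, the other coefficients being fixed, so that summing over the
   leading coefficient first gives W_n = X(D)^n g(X^n) C. *)

(** * The Frobenius map on an extension of [F] *)

Section Frobenius.

Variables (F L : finFieldType) (iota : {rmorphism F -> L}).

(** The embedding is an argument because it forces [L] to have the characteristic of [F], which
    makes this map a ring morphism. *)
Definition frob of {rmorphism F -> L} := fun x : L => x ^+ #|F|.

Lemma pchar_nat_card : [pchar L].-nat #|F|.
Proof.
have [p p_pr pF] := finPcharP F.
have /abelem_pgroup := fin_ring_pchar_abelem pF.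
rewrite /pgroup cardsT; apply: sub_in_pnat => r _; rewrite inE => /eqP ->.
exact: rmorph_pchar pF.
Qed.

Lemma frob_zmod_morphism : zmod_morphism (frob iota).
Proof. move=> x y; have D a b : frob iota (a + b) = frob iota a + frob iota b.
  by rewrite /frob exprDn_pchar ?pchar_nat_card.
by apply/(addIr (frob iota y)); rewrite -D !subrK.
Qed.

Lemma frob_monoid_morphism : monoid_morphism (frob iota).
Proof. by split=> [|x y]; rewrite /frob ?expr1n ?exprMn. Qed.

HB.instance Definition _ :=
  GRing.isZmodMorphism.Build L L (frob iota) frob_zmod_morphism.
HB.instance Definition _ :=
  GRing.isMonoidMorphism.Build L L (frob iota) frob_monoid_morphism.

Lemma frob_inj : injective (frob iota).
Proof. exact: fmorph_inj. Qed.

Lemma frob_iota a : frob iota (iota a) = iota a.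
Proof. by rewrite /frob -rmorphXn /= expf_card. Qed.

(** Over [F] the polynomial [X^q - X] is the product of all [X - a], so a root of its image in [L]
    is some [iota a]. *)
Lemma frob_fixed y : frob iota y = y -> exists a, y = iota a.
Proof.
move=> fy; have : root (map_poly iota ('X^#|F| - 'X)) y.
  by rewrite rmorphB rmorphXn /= map_polyX rootE !hornerE -[_ ^+ _]/(frob iota y) fy subrr.
rewrite finField_genPoly rmorph_prod /= rootE horner_prod => /prodf_eq0[a _].
by rewrite rmorphB /= map_polyX map_polyC /= hornerXsubC subr_eq0 => /eqP ->; exists a.
Qed.

Lemma iter_frob r x : iter r (frob iota) x = x ^+ (#|F| ^ r)%N.
Proof. by elim: r => [|r IH]; rewrite ?expr1 //= IH /frob -exprM -expnSr. Qed.

End Frobenius.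

(** * Polynomials attached to Frobenius orbits *)

Section FrobeniusPolynomial.

Variables (F L : finFieldType) (iota : {rmorphism F -> L}).
Local Notation phi := (frob iota).

(** For [x] in the field with q^r elements this is its reciprocal characteristic polynomial over
    [F], a proper power when [x] lies in a proper subfield containing [F]. *)
Definition frob_poly r x : {poly L} := \prod_(i < r) (1 - iter i phi x *: 'X).

Lemma oneBscaleX_neq0 (a : L) : 1 - a *: 'X != 0.
Proof.
apply/eqP => /(congr1 (fun p : {poly L} => p`_0)).
by rewrite coefB coefZ coefX coef1 coef0 mulr0 subr0; apply/eqP/oner_neq0.
Qed.

Lemma frob_polyD a b x :
  frob_poly (a + b) x = frob_poly a x * frob_poly b (iter a phi x).
Proof.
rewrite /frob_poly big_split_ord /=; congr (_ * _).
by apply: eq_bigr => i _; rewrite -iterD addnC.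
Qed.

Lemma frob_poly_fixed r x :
  iter r phi x = x -> map_poly phi (frob_poly r x) = frob_poly r x.
Proof.
case: r => [|r] fx; first by rewrite /frob_poly big_ord0 rmorph1.
have -> : map_poly phi (frob_poly r.+1 x) = frob_poly r.+1 (phi x).
  rewrite /frob_poly rmorph_prod; apply: eq_bigr => i _ /=.
  by rewrite rmorphB rmorph1 /= map_polyZ map_polyX -iterSr.
(* Frobenius shifts the product by one place. After multiplication by [1 - x *: 'X], the longer
   product is split at its last factor instead of its first, and the last conjugate is [x] again. *)
apply: (mulfI (oneBscaleX_neq0 x)).
rewrite -[1 - _]/(1 - iter 0 phi x *: 'X).
have E1 y : frob_poly 1 y = 1 - y *: 'X by rewrite /frob_poly big_ord1.
rewrite -[1 - _]E1 -[phi x]/(iter 1 phi x) -frob_polyD add1n -addn1 frob_polyD.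
by rewrite fx mulrC.
Qed.

Lemma frob_fixed_poly (g : {poly L}) :
  map_poly phi g = g -> exists h, g = map_poly iota h.
Proof.
move=> fg; have fc i : phi g`_i = g`_i by rewrite -[in RHS]fg coef_map.
have inF i : exists a, g`_i == iota a by have [a ->] := frob_fixed (fc i); exists a.
exists (\poly_(i < size g) xchoose (inF i)); apply/polyP => i.
rewrite coef_map coef_poly /=; case: ltnP => [_|ge]; first exact/eqP/(xchooseP (inF i)).
by rewrite rmorph0 nth_default.
Qed.

Lemma oneBscaleX_eqp (a : L) : a != 0 -> 1 - a *: 'X %= 'X - (a^-1)%:P.
Proof.
move=> a0; apply/eqpP; exists (1, - a); rewrite ?oner_eq0 ?oppr_eq0 //=.
by rewrite scale1r scalerBr !scaleNr scale_polyC divff // opprK addrC.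
Qed.

Lemma size_frob_poly r x : x != 0 -> size (frob_poly r x) = r.+1.
Proof.
move=> x0; have ix i : iter i phi x != 0 by rewrite iter_frob expf_neq0.
have s2 i : size (1 - iter i phi x *: 'X) = 2%N.
  by rewrite (eqp_size (oneBscaleX_eqp (ix i))) size_XsubC.
rewrite /frob_poly size_prod => [|i _]; last by rewrite -size_poly_eq0 s2.
under eq_bigr do rewrite s2.
by rewrite sum_nat_const card_ord muln2 -addnn -addSn addnK.
Qed.

Variables (x : L) (G : {poly L}).
Hypotheses (x0 : x != 0) (G0 : G != 0) (fG : map_poly phi G = G).

Let d := fingraph.order phi x.
Let d_gt0 : (0 < d)%N := fingraph.order_gt0 phi x.
Let iter0 i : iter i phi x != 0.
Proof. by rewrite iter_frob expf_neq0. Qed.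

Let dvd_iter i j :
  ('X - (x^-1)%:P) ^+ j %| G -> (1 - iter i phi x *: 'X) ^+ j %| G.
Proof.
move=> dG; rewrite (eqp_dvdl _ (eqp_exp _ (oneBscaleX_eqp (iter0 i)))).
elim: i => [|i IH]; first exact: dG.
rewrite -fG.
have -> : 'X - ((iter i.+1 phi x)^-1)%:P = map_poly phi ('X - ((iter i phi x)^-1)%:P).
  by rewrite rmorphB /= map_polyX map_polyC /= [phi _^-1]fmorphV.
by rewrite -rmorphXn [_ %| _]dvdp_map.
Qed.

Let iter_eq r : (iter r phi x == x) = (d %| r)%N.
Proof.
have perM j : iter (j * d) phi x = x.
  by elim: j => [|j IH] //; rewrite mulSn iterD IH fingraph.iter_order //; apply: frob_inj.
rewrite {1}(divn_eq r d) addnC iterD perM /dvdn.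
have ltd : (r %% d < d)%N by rewrite ltn_mod d_gt0.
apply/eqP/eqP => [fx|-> //].
by rewrite -(findex_iter ltd) fx -[X in findex _ _ X]/(iter 0 phi x) findex_iter.
Qed.

Let frob_poly_mul j : frob_poly (j * d) x = frob_poly d x ^+ j.
Proof.
elim: j => [|j IH]; first by rewrite /frob_poly big_ord0.
by rewrite mulSn frob_polyD exprS -IH fingraph.iter_order //; apply: frob_inj.
Qed.

(** As [G] is fixed by Frobenius, all conjugates of [x^-1] have the same multiplicity in it; they
    are distinct, so their linear factors are coprime. *)
Let frob_poly_dvd j : (frob_poly d x ^+ j %| G) = (j <= mup x^-1 G)%N.
Proof.
rewrite mup_geq //; apply/idP/idP => [dG|dG].
  rewrite -(eqp_dvdl _ (eqp_exp _ (oneBscaleX_eqp x0))); apply: dvdp_trans dG.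
  apply: dvdp_exp2r; rewrite -(prednK d_gt0) /frob_poly big_ord_recl.
  exact: dvdp_mulr.
suff /(_ d (leqnn _)) : forall m, (m <= d)%N -> frob_poly m x ^+ j %| G by [].
elim=> [|m IH] lemd; first by rewrite /frob_poly big_ord0 expr1n dvd1p.
rewrite -addn1 frob_polyD exprMn Gauss_dvdp ?IH 1?ltnW //=.
  by rewrite /frob_poly big_ord1 dvd_iter.
rewrite coprimep_expl // coprimep_expr //.
rewrite /frob_poly [X in coprimep _ X]big_ord1 (eqp_coprimepr _ (oneBscaleX_eqp (iter0 m))).
rewrite coprimep_XsubC rootE horner_prod prodf_seq_neq0; apply/allP => i _ /=.
rewrite !hornerE subr_eq0 eq_sym; apply/eqP => /divr1_eq eqim.
have := findex_iter lemd; rewrite -eqim findex_iter ?(ltn_trans (ltn_ord i)) //.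
by move=> eq_im; have := ltn_ord i; rewrite eq_im ltnn.
Qed.

(* The contributing [r] are the multiples [j * d] of the degree [d] of [x] over [F],
   and then [frob_poly r x] is the [j]-th power of a polynomial with simple roots,
   the conjugates of [x^-1]. *)
Lemma count_frob_poly_dvd k : (size G <= k.+1)%N ->
  (\sum_(1 <= r < k.+1) ((iter r phi x == x) && (frob_poly r x %| G)%R))%N =
  mup x^-1 G.
Proof.
move=> sG; set mu := mup _ _.
(* A polynomial of degree [mu * d] divides [G], whose degree is at most [k]: every contributing [r]
   lies in the range of summation. *)
have le_k : (mu * d <= k)%N.
  rewrite -ltnS -(size_frob_poly _ x0) (leq_trans _ sG) // dvdp_leq //.
  by rewrite frob_poly_mul frob_poly_dvd.
rewrite (big_cat_nat (n := (mu * d).+1)) ?ltnS //=.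
rewrite [X in (_ + X)%N]big_nat [X in (_ + X)%N]big1 => [|r /andP[gt_r _]].
  rewrite addn0 -[RHS](mulnK mu d_gt0) divn_count_dvd.
  rewrite !big_nat; apply: eq_bigr => r /andP[_]; rewrite ltnS iter_eq -/d => le_r.
  case: (boolP (d %| r)%N) => //= /dvdnP[j def_r].
  by rewrite def_r frob_poly_mul frob_poly_dvd -(leq_pmul2r d_gt0) -def_r le_r.
rewrite iter_eq; case: (boolP (d %| r)%N) => //= /dvdnP[j def_r].
rewrite def_r frob_poly_mul frob_poly_dvd -(leq_pmul2r d_gt0) -def_r.
by rewrite leqNgt gt_r.
Qed.

End FrobeniusPolynomial.

(** * Weighted sums over polynomials with constant term 1 *)

Definition unit_poly (R : nzRingType) k (g : {poly R}) :=
  (g`_0 == 1) && (size g == k.+1).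

(** The coefficient of [T ^ k] in the generating function of [w]. The size bound makes the index
    type finite, and for [k <= n] it excludes no polynomial of degree [k]. *)
Definition unit_poly_sum (F : finFieldType) n (w : {poly F} -> algC) k :=
  \sum_(g : {poly_n.+1 F} | unit_poly k g) w g.

Definition poly_weight (F : finFieldType) (w : {poly F} -> algC) :=
  forall g h : {poly F}, g`_0 = 1 -> h`_0 = 1 -> w (g * h) = w g * w h.

(** Multiplication by [c] maps degree [k - r] bijectively onto the multiples of [c] in degree [k];
    both degrees are at most [n], so the truncation [npolyp] changes nothing. *)
Lemma unit_poly_sum_dvd (F : finFieldType) n (w : {poly F} -> algC) c r k :
  poly_weight w -> unit_poly r c -> (r <= k <= n)%N ->
  \sum_(g : {poly_n.+1 F} | unit_poly k g && (c %| g)) w g =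
  w c * unit_poly_sum n w (k - r).
Proof.
move=> wM /andP[/eqP c0 /eqP sc] /andP[le_rk le_kn]; rewrite /unit_poly_sum big_distrr /=.
have cn0 : c != 0 by rewrite -size_poly_eq0 sc.
have smul (g : {poly F}) : g != 0 -> size (c * g) = (r + size g)%N.
  by move=> g0; rewrite size_mul // sc.
have un0 j (g : {poly F}) : unit_poly j g -> g != 0.
  by case/andP=> _ /eqP sg; rewrite -size_poly_eq0 sg.
have KL j g : unit_poly j g -> (j <= n)%N -> npolyp n.+1 g = g :> {poly F}.
  by case/andP=> _ /eqP sg lej; rewrite npolypK // sg.
have cM (g : {poly F}) : unit_poly (k - r) g -> unit_poly k (c * g).
  move=> ug; have g0 := un0 _ _ ug; case/andP: ug => /eqP g1 /eqP sg.
  by rewrite /unit_poly coef0M c0 g1 mulr1 eqxx /= smul // sg addnS subnKC.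
have cD (g : {poly F}) : unit_poly k g -> c %| g -> unit_poly (k - r) (g %/ c).
  move=> ug /divpK gK; have g0 := un0 _ _ ug; case/andP: ug => /eqP g1 /eqP sg.
  rewrite /unit_poly size_divp // sg sc /= subSn // eqxx andbT.
  by have := coef0M (g %/ c) c; rewrite gK g1 c0 mulr1 => <-.
rewrite (reindex_onto (fun g : {poly_n.+1 F} => npolyp n.+1 (c * g))
                      (fun g : {poly_n.+1 F} => npolyp n.+1 (g %/ c))) /=; last first.
  move=> g /andP[ug cg]; apply/val_inj => /=.
  have u1 := cD _ ug cg; rewrite (KL _ _ u1) ?(leq_trans (leq_subr _ _)) //.
  by rewrite mulrC divpK // npolypK // size_npoly.
have lekrn : (k - r <= n)%N by rewrite (leq_trans (leq_subr _ _)).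
rewrite (eq_bigl (fun g : {poly_n.+1 F} => unit_poly (k - r) g)) => [|g /=].
  apply: eq_bigr => g ug; rewrite (KL k) // ?cM // wM //.
  by case/andP: ug => /eqP.
apply/idP/idP => [/andP[/andP[u1 cg] /eqP/(congr1 val) /= <-]|ug].
  have ucg := cD _ u1 cg; by rewrite (KL _ _ ucg).
have ucg := cM _ ug; rewrite (KL k) // ucg dvdp_mulr //=.
by apply/eqP/val_inj; rewrite /= mulrC mulpK // npolypK // size_npoly.
Qed.

(** * The recurrence given by the logarithmic derivative *)

Section Recurrence.

Variables (F L : finFieldType) (iota : {rmorphism F -> L}) (n : nat).
Local Notation phi := (frob iota).
Hypothesis split_iota : forall g : {poly F}, g != 0 -> (size g <= n.+1)%N ->
  exists rs, map_poly iota g %= \prod_(r <- rs) ('X - r%:P).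

Definition unfrob (y : L) : F := odflt 0 [pick a | iota a == y].

Lemma unfrobK a : unfrob (iota a) = a.
Proof.
rewrite /unfrob; case: pickP => [b /eqP/fmorph_inj // | /(_ a)].
by rewrite eqxx.
Qed.

Definition base_frob_poly r x := map_poly unfrob (frob_poly iota r x).

Lemma base_frob_polyK r x : iter r phi x = x ->
  map_poly iota (base_frob_poly r x) = frob_poly iota r x.
Proof.
move=> fx; have [h def_h] := frob_fixed_poly (frob_poly_fixed fx).
rewrite /base_frob_poly def_h; congr (map_poly _ _); apply/polyP => i.
have u0 : unfrob 0 = 0 by rewrite -(rmorph0 iota) unfrobK.
by rewrite coef_map_id0 // coef_map /= unfrobK.
Qed.

Lemma base_frob_polyP r x : x != 0 -> iter r phi x = x ->
  unit_poly r (base_frob_poly r x).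
Proof.
move=> x0 fx; rewrite /unit_poly -(inj_eq (fmorph_inj iota)) -coef_map.
rewrite -(size_map_poly iota) base_frob_polyK // size_frob_poly // eqxx andbT.
rewrite rmorph1 -horner_coef0 /frob_poly horner_prod big1 // => i _.
by rewrite !hornerE ?mulr0 ?subr0.
Qed.

(** Over [L] the polynomial splits, and its constant term 1 keeps 0 from being a root. *)
Lemma sum_mup (g : {poly F}) k : (k <= n)%N -> unit_poly k g ->
  (\sum_(x : L | (x != 0)%R) mup x^-1 (map_poly iota g))%N = k.
Proof.
move=> le_kn /andP[/eqP g0 /eqP sg].
have gn0 : g != 0 by rewrite -size_poly_eq0 sg.
have [|rs def_g] := split_iota gn0; first by rewrite sg.
have mupE x : mup x (map_poly iota g) = count_mem x rs.
  have pn0 : \prod_(r <- rs) ('X - r%:P) != 0 :> {poly L}.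
    by apply: monic_neq0; apply: monic_prod_XsubC.
  rewrite -mu_prod_XsubC; apply/eqP; rewrite eqn_leq.
  rewrite mup_geq // -(eqp_dvdr _ def_g) -mup_geq ?map_poly_eq0 // leqnn /=.
  by rewrite mup_geq ?map_poly_eq0 // (eqp_dvdr _ def_g) -mup_geq.
have nr0 : mup 0 (map_poly iota g) = 0%N.
  by rewrite mupNroot // rootE horner_coef0 coef_map /= g0 rmorph1 oner_eq0.
have szrs : size rs = k.
  have := eqp_size def_g; rewrite size_map_poly sg size_prod_XsubC.
  by case.
transitivity (\sum_(x : L) mup x (map_poly iota g))%N.
  rewrite [RHS](bigD1 0) //= nr0 add0n (reindex_inj invr_inj) /=.
  by apply: eq_big => x; rewrite ?invr_eq0 ?invrK.
rewrite -szrs; under eq_bigr do rewrite mupE.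
elim: rs {def_g mupE szrs} => [|y rs IH] /=; first by rewrite big1.
by rewrite big_split /= IH (bigD1 y) //= eqxx big1 // => x /negPf; rewrite eq_sym => ->.
Qed.

(** For a multiplicative [w] with generating function [W], and [L] containing the field with q^r
    elements, this is the coefficient of [T ^ r] in [T W' / W]. *)
Definition frob_sum (w : {poly F} -> algC) r :=
  \sum_(x : L | (x != 0) && (iter r phi x == x)) w (base_frob_poly r x).

(** The degree of [g] is the number of pairs of [r] and [x] for which [base_frob_poly r x] divides
    [g]. Summing over [g] first, for each fixed pair, gives the right-hand side. *)
Lemma unit_poly_sum_rec w k : poly_weight w -> (k <= n)%N ->
  k%:R * unit_poly_sum n w k =
  \sum_(1 <= r < k.+1) frob_sum w r * unit_poly_sum n w (k - r).
Proof.
move=> wM le_kn; rewrite big_distrr /=.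
transitivity (\sum_(g : {poly_n.+1 F} | unit_poly k g)
   \sum_(1 <= r < k.+1) \sum_(x : L | (x != 0) && (iter r phi x == x))
     if base_frob_poly r x %| g then w g else 0).
  apply: eq_bigr => g ug; rewrite -{1}(sum_mup le_kn ug) natr_sum mulr_suml.
  under [RHS]eq_bigr do rewrite big_mkcondr /=.
  rewrite exchange_big /=; apply: eq_bigr => x x0.
  have [/eqP g0 /eqP sg] := andP ug.
  rewrite -(@count_frob_poly_dvd _ _ iota _ _ x0 _ _ k); last first.
  - by rewrite size_map_poly sg.
  - rewrite -map_poly_comp; apply: eq_map_poly => a; exact: frob_iota.
  - by rewrite map_poly_eq0 -size_poly_eq0 sg.
  rewrite natr_sum mulr_suml; apply: eq_bigr => r _.
  case: eqP => [fx|_] /=; last by rewrite mul0r.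
  rewrite -(dvdp_map iota) base_frob_polyK //.
  by case: ifP; rewrite (mul1r, mul0r).
rewrite exchange_big /= !big_nat; apply: eq_bigr => r /andP[r_gt0 le_rk].
rewrite exchange_big /= /frob_sum mulr_suml; apply: eq_bigr => x /andP[x0 /eqP fx].
by rewrite -big_mkcondr /= (unit_poly_sum_dvd (r := r)) ?base_frob_polyP // -ltnS le_rk.
Qed.

End Recurrence.

(** * Splitting fields and n-th powers in them *)

Lemma splitting_extension (F : finFieldType) N :
  exists (L : finFieldType) (iota : {rmorphism F -> L}),
  forall g : {poly F}, g != 0 -> (size g <= N)%N ->
  exists rs, map_poly iota g %= \prod_(r <- rs) ('X - r%:P).
Proof.
(* There are finitely many polynomials of bounded size, so one field can split their product. *)
pose p : {poly F} := \prod_(g : {poly_N F} | val g != 0) val g.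
have p0 : p != 0 by rewrite prodf_seq_neq0; apply/allP => g _; apply/implyP.
have [L [zs Dp _]] := FinSplittingFieldFor p0.
exists (finvect_type L), (in_alg (finvect_type L)) => g g0 sg.
have : map_poly (in_alg (finvect_type L)) g %| \prod_(z <- zs) ('X - z%:P).
  rewrite -(eqp_dvdr _ Dp) [_ %| _]dvdp_map /p (bigD1 (NPoly (sg : g \is a poly_of_size N))) //=.
  exact: dvdp_mulr.
by case/dvdp_prod_XsubC => m Dg; exists (mask m zs).
Qed.

Lemma prim_root_neq0 (R : fieldType) n (z : R) : n.-primitive_root z -> z != 0.
Proof.
move=> zP; apply/eqP => z0; have := prim_expr_order zP.
rewrite z0 expr0n gtn_eqF ?(prim_order_gt0 zP) // => /eqP.
by rewrite eq_sym oner_eq0.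
Qed.

Section PowerMap.

Variables (F L : finFieldType) (iota : {rmorphism F -> L}) (N : nat).
Local Notation phi := (frob iota).
Hypothesis split_iota : forall g : {poly F}, g != 0 -> (size g <= N)%N ->
  exists rs, map_poly iota g %= \prod_(r <- rs) ('X - r%:P).

(** For [M = q^r - 1] the polynomial [X^M - 1] has size [q^r <= N], so it splits in [L]. It is
    separable because q is 0 in [L], so that [M] is -1 there. *)
Lemma ex_prim_root r : (0 < r)%N -> (#|F| ^ r <= N)%N ->
  exists z : L, (#|F| ^ r).-1.-primitive_root z.
Proof.
move=> r_gt0 le_rN; set M := (_ ^ r).-1.
have q_gt1 : (1 < #|F|)%N := finNzRing_gt1 F.
have defM : M.+1 = (#|F| ^ r)%N by rewrite prednK // expn_gt0 ltnW.
have M_gt0 : (0 < M)%N by rewrite -ltnS defM -{1}(exp1n r) ltn_exp2r.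
have sM : size ('X^M - 1 : {poly F}) = M.+1 by rewrite size_XnsubC.
have [||rs Drs] := split_iota (g := 'X^M - 1).
- by rewrite -size_poly_eq0 sM.
- by rewrite sM defM.
rewrite rmorphB rmorph1 /= map_polyXn in Drs.
have Urs : uniq rs.
  rewrite -separable_prod_XsubC -(eqp_separable Drs) cyclotomic.separable_Xn_sub_1 //.
  have qL0 : #|F|%:R = 0 :> L.
    have [p p_pr pF] := finPcharP F.
    have pL : p \in [pchar L] by apply: rmorph_pchar pF.
    have /abelem_pgroup := fin_ring_pchar_abelem pF; rewrite /pgroup cardsT => pq.
    have [e qe] := p_natP pq; have e_gt0 : (0 < e)%N by move: q_gt1; rewrite qe; case: (e).
    by rewrite qe natrX (pcharf0 pL) expr0n eqn0Ngt e_gt0.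
  apply/eqP => M0; have := congr1 (fun m => m%:R : L) defM.
  by rewrite mulrS M0 addr0 natrX qL0 expr0n eqn0Ngt r_gt0 => /eqP; rewrite oner_eq0.
have szrs : size rs = M.
  by have := eqp_size Drs; rewrite size_XnsubC // size_prod_XsubC => -[].
have /hasP[z _ zP] : has M.-primitive_root rs.
  apply: has_prim_root; rewrite ?szrs //; apply/allP => x.
  by rewrite -root_prod_XsubC -(eqp_root Drs) unity_rootE /root !hornerE subr_eq0.
by exists z.
Qed.

Variables (n : nat) (zeta : F) (r : nat).
Hypotheses (zeta_prim : n.-primitive_root zeta).
Hypotheses (r_gt0 : (0 < r)%N) (le_rN : (#|F| ^ r <= N)%N).

Let n_gt0 : (0 < n)%N := prim_order_gt0 zeta_prim.

Lemma prim_root_dvd_card : (n %| #|F|.-1)%N.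
Proof.
have z0 := prim_root_neq0 zeta_prim.
rewrite (prim_order_dvd zeta_prim); apply/eqP/(mulfI z0).
by rewrite mulr1 -exprS prednK ?expf_card // ltnW ?finNzRing_gt1.
Qed.

Let M := (#|F| ^ r).-1.
Let dvd_nM : (n %| M)%N.
Proof. by rewrite /M predn_exp dvdn_mulr ?prim_root_dvd_card. Qed.

Let defM : M.+1 = (#|F| ^ r)%N.
Proof. by rewrite prednK // expn_gt0 ltnW ?finNzRing_gt1. Qed.

Let fixedE x : x != 0 -> (iter r phi x == x) = (x ^+ M == 1).
Proof.
move=> x0; rewrite iter_frob -defM exprS -[X in _ == X]mulr1.
exact: (inj_eq (mulfI x0)).
Qed.

(** In the cyclic group of order [M = q^r - 1] an element has [n] n-th roots if its power of
    exponent [M %/ n] is 1, and none otherwise. *)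
Lemma nth_power_sum (f : L -> algC) :
  \sum_(x : L | (x != 0) && (iter r phi x == x)) f (x ^+ n) =
  \sum_(t : L | (t != 0) && (iter r phi t == t))
     (if t ^+ (M %/ n) == 1 then n%:R else 0) * f t.
Proof.
have zi : n.-primitive_root (iota zeta) by rewrite fmorph_primitive_root.
have z0 := prim_root_neq0 zi.
rewrite (partition_big (fun x => x ^+ n)
  (fun t => (t != 0) && (iter r phi t == t))) /=; last first.
  move=> x /andP[x0]; rewrite !fixedE ?expf_neq0 // => /eqP xM.
  by rewrite -exprM mulnC exprM xM expr1n eqxx.
apply: eq_bigr => t /andP[t0 ft].
rewrite (eq_bigr (fun _ => f t)) => [|x /andP[_ /eqP->] //].
rewrite sumr_const -[LHS]mulr_natl; congr (_ * _).
case: eqP => [tMn|tMn]; last first.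
  rewrite (eq_card0 (A := _)) // => x; rewrite inE /=.
  apply/negP => /andP[/andP[x0 fx] /eqP xt].
  by apply: tMn; rewrite -xt -exprM mulnC divnK //; apply/eqP; rewrite -fixedE.
have [z zP] := ex_prim_root r_gt0 le_rN.
have [i ti] : exists i, t = z ^+ i.
  have tM : t ^+ M = 1 by apply/eqP; rewrite -fixedE.
  by have [i ->] := prim_rootP zP tM; exists i.
have /dvdnP[j ij] : (n %| i)%N.
  have Mn : (0 < M %/ n)%N.
    by rewrite divn_gt0 // dvdn_leq // (prim_order_gt0 zP).
  rewrite -(dvdn_pmul2r Mn) [(n * _)%N]mulnC divnK // (prim_order_dvd zP).
  by rewrite exprM -ti tMn.
pose y := z ^+ j; have yt : y ^+ n = t by rewrite ti ij exprM.
have y0 : y != 0 by apply: contraNneq t0 => y0; rewrite -yt y0 expr0n gtn_eqF.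
have fy : y ^+ M = 1 by rewrite /y -exprM mulnC exprM (prim_expr_order zP) ?expr1n.
have zM : iota zeta ^+ M = 1 by apply/eqP; rewrite -(prim_order_dvd zi).
rewrite -[in RHS](card_ord n); congr (_%:R).
rewrite -[RHS](card_image (f := fun l : 'I_n => y * iota zeta ^+ l)); last first.
  move=> l1 l2 /(mulfI y0)/eqP; rewrite (eq_prim_root_expr zi) !modn_small // => /eqP.
  exact: val_inj.
apply: eq_card => x; apply/idP/imageP => [/andP[/andP[x0 _] /eqP xt]|[l _ ->]].
  have /(prim_rootP zi)[l xl] : (x / y) ^+ n = 1.
    by rewrite expr_div_n xt yt divff.
  by exists l => //; rewrite -xl mulrC divfK.
have yl0 : y * iota zeta ^+ l != 0 by apply: mulf_neq0 => //; apply: expf_neq0.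
apply/andP; split; last first.
  by rewrite exprMn yt -exprM mulnC exprM (prim_expr_order zi) expr1n mulr1.
apply/andP; split=> //; rewrite fixedE // exprMn fy mul1r.
by rewrite exprAC zM expr1n.
Qed.

End PowerMap.

(** * Products of twists by roots of unity *)

Lemma coef_comp_scaleX (R : comNzRingType) (g : {poly R}) a i :
  (g \Po (a *: 'X))`_i = a ^+ i * g`_i.
Proof.
rewrite comp_polyE coef_sum.
under eq_bigr => j _ do rewrite exprZn !coefZ coefXn.
have [ltig|leig] := ltnP i (size g).
  rewrite (bigD1 (Ordinal ltig)) //= eqxx mulr1 big1 ?addr0 1?mulrC // => j.
  by rewrite -val_eqE /= eq_sym => /negPf->; rewrite !mulr0.
rewrite [g`_i]nth_default // mulr0 big1 // => j _.
by rewrite gtn_eqF ?mulr0 // (leq_trans (ltn_ord j)).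
Qed.

Lemma coefM_ends (R : nzRingType) (p q : {poly R}) n : (0 < n)%N ->
  (p * q)`_n = p`_0 * q`_n + \sum_(i < n.-1) p`_i.+1 * q`_(n - i.+1)
               + p`_n * q`_0.
Proof.
case: n => // n _; rewrite coefM big_ord_recl big_ord_recr /= addrA subnn subn0.
by rewrite /bump /= add1n.
Qed.

Section Twist.

Variables (R : fieldType) (n : nat) (z : R).
Implicit Types g h : {poly R}.

(** For [z] a primitive n-th root of unity this is the norm of [g] down to polynomials in [T ^ n].
    If [g] has constant term 1, the coefficient of [T ^ n] is minus the n-th power sum of the
    reciprocal roots, obtained without factoring [g]. *)
Definition twist_prod g : {poly R} := \prod_(l < n) (g \Po (z ^+ l *: 'X)).

Lemma twist_prodM g h : twist_prod (g * h) = twist_prod g * twist_prod h.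
Proof. by rewrite -big_split; apply: eq_bigr => l _; rewrite comp_polyM. Qed.

Lemma coef0_twist_prod g : (twist_prod g)`_0 = g`_0 ^+ n.
Proof.
rewrite coef0_prod -[in RHS](card_ord n) -prodr_const; apply: eq_bigr => l _.
by rewrite coef_comp_scaleX mul1r.
Qed.

Hypothesis zP : n.-primitive_root z.
Let n_gt0 : (0 < n)%N := prim_order_gt0 zP.

Lemma twist_prod_invariant g : twist_prod g \Po (z *: 'X) = twist_prod g.
Proof.
rewrite /twist_prod rmorph_prod /=.
have -> : \prod_(l < n) ((g \Po (z ^+ l *: 'X)) \Po (z *: 'X)) =
          \prod_(l < n) (g \Po (z ^+ l.+1 *: 'X)).
  apply: eq_bigr => l _; apply/polyP => i.
  by rewrite !coef_comp_scaleX mulrA -exprMn -exprS.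
rewrite -(prednK n_gt0) big_ord_recr big_ord_recl /= prednK // mulrC.
by rewrite (prim_expr_order zP).
Qed.

Lemma coef_twist_prod g i : (0 < i < n)%N -> (twist_prod g)`_i = 0.
Proof.
move=> /andP[i_gt0 lt_in]; apply/eqP.
have /eqP := coef_comp_scaleX (twist_prod g) z i.
rewrite twist_prod_invariant -subr_eq0 -{1}[_`_i]mul1r -mulrBl mulf_eq0.
rewrite subr_eq0 eq_sym -(prim_order_dvd zP) => /orP[] //.
by rewrite gtnNdvd.
Qed.

(** Only the end terms of the convolution survive, as the coefficients strictly between 0 and [n]
    vanish. *)
Lemma coef_twist_prodM g h : g`_0 = 1 -> h`_0 = 1 ->
  (twist_prod (g * h))`_n = (twist_prod g)`_n + (twist_prod h)`_n.
Proof.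
move=> g0 h0; rewrite twist_prodM coefM_ends // big1 => [|i _]; last first.
  by rewrite coef_twist_prod ?mul0r //= -ltn_predRL.
by rewrite !coef0_twist_prod g0 h0 !expr1n addr0 mul1r mulr1 addrC.
Qed.

Lemma coef_twist_prod_lin a : (twist_prod (1 - a *: 'X))`_n = - a ^+ n.
Proof.
have [->|a0] := eqVneq a 0.
  rewrite scale0r subr0 expr0n gtn_eqF // oppr0 /twist_prod big1 ?coef1 ?gtn_eqF //.
  by move=> l _; rewrite -[1]/(1%:P) comp_polyC.
set P := twist_prod _.
have defP : P = 1 + P`_n *: 'X^n.
  apply/polyP => i; rewrite coefD coef1 coefZ coefXn.
  have [->|i_gt0] := posnP i.
    rewrite coef0_twist_prod coefB coef1 coefZ coefX mulr0 subr0 expr1n.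
    by rewrite [0%N == n]ltn_eqF // mulr0 addr0.
  have [ltin|ltni|->] := ltngtP i n.
  - by rewrite coef_twist_prod ?i_gt0 // mulr0 addr0.
  - rewrite mulr0 addr0 nth_default // (leq_trans _ ltni) //.
    rewrite (leq_trans (size_prod_leq _ _)) // card_ord leq_subLR addnS ltnS.
    rewrite addnn -mul2n mulnC -[X in (_ <= X * _)%N]card_ord -sum_nat_const.
    apply: leq_sum => l _; apply/leq_sizeP => j; rewrite coef_comp_scaleX.
    by case: j => [|[|j]] // _; rewrite coefB coef1 coefZ coefX !mulr0 subr0 mulr0.
  - by rewrite mulr1 add0r.
(* The factor with [l = 0] vanishes at [a^-1], which determines the one unknown coefficient of
   [P]. *)
have Pa : P.[a^-1] = 0.
  rewrite /P /twist_prod horner_prod (bigD1 (Ordinal n_gt0)) //= expr0 scale1r.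
  by rewrite comp_polyXr !hornerE divff // subrr mul0r.
have /eqP : 1 + P`_n / a ^+ n = 0 
  by rewrite -[RHS]Pa [in RHS]defP !hornerE exprVn.
rewrite addrC addr_eq0 => /eqP an; apply: (mulIf (_ : (a ^+ n)^-1 != 0)).
  by rewrite invr_eq0 expf_neq0.
by rewrite an mulNr divff ?expf_neq0.
Qed.

(** Each of the [n] factors changes by [c T ^ n], since the n-th power of [z ^+ l] is 1, and the
    constant terms are 1. The induction on the number of factors carries along that lower
    coefficients stay the same. *)
Lemma coef_twist_prod_add (h : {poly R}) c : (size h <= n)%N -> h`_0 = 1 ->
  (twist_prod (h + c *: 'X^n))`_n = (twist_prod h)`_n + n%:R * c.
Proof.
move=> sh h0.
suff /(_ n)[_ ->] : forall m, (forall i, (i < n)%N ->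
      (\prod_(l < m) ((h + c *: 'X^n) \Po (z ^+ l *: 'X)))`_i =
      (\prod_(l < m) (h \Po (z ^+ l *: 'X)))`_i) /\
    (\prod_(l < m) ((h + c *: 'X^n) \Po (z ^+ l *: 'X)))`_n =
      (\prod_(l < m) (h \Po (z ^+ l *: 'X)))`_n + m%:R * c by [].
elim=> [|m [IHi IHn]]; first by rewrite !big_ord0 mul0r addr0.
have defE i : ((h + c *: 'X^n) \Po (z ^+ m *: 'X))`_i =
    (h \Po (z ^+ m *: 'X))`_i + c *+ (i == n).
  rewrite !coef_comp_scaleX coefD mulrDr coefZ coefXn; congr (_ + _).
  case: eqP => [->|_]; rewrite ?mulr0 //.
  by rewrite -exprM mulnC exprM (prim_expr_order zP) expr1n mulr1 mul1r.
have P0 : (\prod_(l < m) (h \Po (z ^+ l *: 'X)))`_0 = 1.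
  by rewrite coef0_prod big1 // => l _; rewrite coef_comp_scaleX h0 mulr1.
split=> [i lt_in|].
  rewrite !big_ord_recr !coefM; apply: eq_bigr => j _ /=.
  rewrite IHi ?defE ?ltn_eqF ?addr0 ?(leq_ltn_trans (leq_subr _ _)) //.
  by rewrite (leq_ltn_trans _ lt_in) // -ltnS.
have H0 : (h \Po (z ^+ m *: 'X))`_0 = 1 by rewrite coef_comp_scaleX h0 mulr1.
rewrite !big_ord_recr /= !coefM_ends // !defE IHi // IHn P0 H0.
rewrite eqxx [0%N == n]ltn_eqF // mulr1n addr0 !mul1r !mulr1.
rewrite [X in _ + X + _ = _](eq_bigr (fun i : 'I_n.-1 =>
    (\prod_(l < m) (h \Po (z ^+ l *: 'X)))`_i.+1 *
    (h \Po (z ^+ m *: 'X))`_(n - i.+1))) => [|i _]; last first.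
  rewrite IHi ?defE; last by rewrite -ltn_predRL.
  by rewrite ltn_eqF ?addr0 // ltn_subrL n_gt0.
rewrite -natr1 mulrDl mul1r -!addrA [c + _]addrC -!addrA.
by do 3?congr (_ + _); rewrite addrC.
Qed.

End Twist.

(** * Characters as functions on [F], and their weights *)

Definition mul_char (F : finFieldType) (X : F -> algC) :=
  [/\ {morph X : x y / x * y}, X 0 = 0 & X 1 = 1].

Definition add_char (F : finFieldType) (theta : F -> algC) :=
  {morph theta : x y / x + y >-> x * y} /\ theta 0 = 1.

Section CharWeight.

Variables (F : finFieldType) (theta : F -> algC).
Hypothesis thetaP : add_char theta.

Let thetaD : {morph theta : x y / x + y >-> x * y} := proj1 thetaP.
Let theta0 : theta 0 = 1 := proj2 thetaP.

(* For [g = \prod_i (1 - a_i *: 'X)], [twist_prod n z g] is [\prod_i (1 - a_i ^+ n *: 'X^n)],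
   so that [theta] is evaluated at the [n]-th power sum of the [a_i]. *)
Definition char_weight (X : F -> algC) n z (g : {poly F}) : algC :=
  X ((-1) ^+ (size g).-1 * lead_coef g) * theta (- (twist_prod n z g)`_n).

Lemma char_weightM X n z : mul_char X -> n.-primitive_root z ->
  poly_weight (char_weight X n z).
Proof.
move=> [XM _ _] zP g h g0 h0; rewrite /char_weight coef_twist_prodM //.
have nz (p : {poly F}) : p`_0 = 1 -> p != 0.
  by apply: contra_eq_neq => ->; rewrite coef0 eq_sym oner_neq0.
rewrite size_mul ?nz // lead_coefM opprD thetaD.
have -> : (size g + size h).-1.-1 = ((size g).-1 + (size h).-1)%N.
  by rewrite (polySpred (nz _ g0)) (polySpred (nz _ h0)) /= addnS.
by rewrite exprD mulrACA XM mulrACA.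
Qed.

Lemma twist_prod1 (g : {poly F}) : twist_prod 1 1 g = g.
Proof. by rewrite /twist_prod big_ord1 expr0 scale1r comp_polyXr. Qed.

Lemma unit_poly_sum_char0 n X m z : (0 < m)%N -> mul_char X ->
  unit_poly_sum n (char_weight X m z) 0 = 1.
Proof.
move=> m_gt0 [_ _ X1]; rewrite /unit_poly_sum.
have s1 : (size (1 : {poly F})%R <= n.+1)%N by rewrite size_poly1.
rewrite (big_pred1 (NPoly (s1 : 1 \is a poly_of_size n.+1))) => [|g].
  rewrite /char_weight /= size_poly1 expr0 lead_coef1 mul1r X1.
  have -> : twist_prod m z (1 : {poly F}) = 1.
    by rewrite /twist_prod big1 // => l _; rewrite -[1]/(1%:P) comp_polyC.
  by rewrite coef1 gtn_eqF // oppr0 theta0 mulr1.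
rewrite /= -val_eqE /= /unit_poly; apply/andP/eqP => [[/eqP g0 /eqP/eqP]|->].
  by move/size_poly1P => [c _ gc]; move: g0; rewrite gc coefC /= => ->.
by rewrite size_poly1 coef1.
Qed.

Lemma unit_poly_sum_char1 n X : (0 < n)%N -> mul_char X ->
  unit_poly_sum n (char_weight X 1 1) 1 = \sum_x X x * theta x.
Proof.
move=> n_gt0 [XM X0 X1]; rewrite /unit_poly_sum.
rewrite [RHS](bigD1 0) //= X0 mul0r add0r.
rewrite (reindex_onto (fun c : F => npolyp n.+1 (1 - c *: 'X))
   (fun g : {poly_n.+1 F} => - g`_1)) /=; last first.
  move=> g /andP[/eqP g0 /eqP sg]; apply/val_inj => /=.
  have -> : 1 - (- g`_1) *: 'X = g :> {poly F}.
    apply/polyP => i; rewrite coefB coef1 coefZ coefX.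
    case: i => [|[|i]] /=; first by rewrite mulr0 subr0.
      by rewrite mulr1 sub0r opprK.
    by rewrite mulr0 subr0 nth_default ?sg.
  by rewrite npolypK // size_npoly.
have sl (c : F) : (size (1 - c *: 'X : {poly F})%R <= 2)%N.
  apply/leq_sizeP => -[|[|j]] // _; rewrite coefB coef1 coefZ coefX mulr0 subr0 //.
have nK (c : F) : npolyp n.+1 (1 - c *: 'X) = 1 - c *: 'X :> {poly F}.
  by rewrite npolypK // (leq_trans (sl c)).
have c1 (c : F) : (1 - c *: 'X : {poly F})%R`_1 = - c.
  by rewrite coefB coef1 coefZ coefX /= mulr1 sub0r.
have c0 (c : F) : (1 - c *: 'X : {poly F})%R`_0 = 1.
  by rewrite coefB coef1 coefZ coefX mulr0 subr0.
have s2 (c : F) : c != 0 -> size (1 - c *: 'X : {poly F})%R = 2%N.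
  move=> cn0; apply/eqP; rewrite eqn_leq sl /= ltnNge.
  apply/negP => /leq_sizeP/(_ 1%N (leqnn _))/eqP.
  by rewrite c1 oppr_eq0 (negPf cn0).
apply: eq_big => [c|c].
  rewrite /unit_poly nK c0 c1 opprK !eqxx andbT /=.
  have [->|cn0] := eqVneq c 0; last by rewrite s2.
  by rewrite scale0r subr0 size_poly1.
rewrite /unit_poly /= nK => /andP[/andP[_ sc] _].
rewrite /char_weight twist_prod1 c1 opprK lead_coefE (eqP sc) /= c1.
by rewrite expr1 mulN1r opprK.
Qed.

(** Subtracting [s T] keeps the leading coefficient, since [k > 1], and multiplies the weight by
    [theta s]; hence [E = theta s * E]. *)
Lemma unit_poly_sum_char_gt1 n X k : (1 < k <= n)%N ->
  (exists s, theta s != 1) -> unit_poly_sum n (char_weight X 1 1) k = 0.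
Proof.
move=> /andP[k_gt1 le_kn] [s ths1]; set E := unit_poly_sum _ _ _.
suff /eqP : E = theta s * E.
  rewrite -{1}[E]mul1r -subr_eq0 -mulrBl mulf_eq0 subr_eq0 eq_sym (negPf ths1).
  by move/eqP.
rewrite {1}/E /unit_poly_sum /E mulr_sumr.
pose sX : {poly_n.+1 F} := npolyp n.+1 (s *: 'X).
have sXE : sX = s *: 'X :> {poly F}.
  rewrite npolypK // (leq_trans (size_scale_leq _ _)) // size_polyX.
  by rewrite ltnS ltnW // (leq_trans k_gt1).
have sz (g : {poly F}) : size g = k.+1 -> size (g - s *: 'X) = k.+1.
  move=> sg; rewrite size_polyDl // size_polyN sg.
  by rewrite (leq_ltn_trans (size_scale_leq _ _)) // size_polyX ltnS.
have szE (g : {poly F}) : (size (g - s *: 'X)%R == k.+1) = (size g == k.+1).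
  apply/eqP/eqP => [sg|]; last exact: sz.
  rewrite -[g](subrK (s *: 'X)) size_polyDl // sg.
  by rewrite (leq_ltn_trans (size_scale_leq _ _)) // size_polyX ltnS.
rewrite (reindex_inj (subIr sX)) /=; apply: eq_big => [g|g].
  by rewrite /unit_poly sXE coefB coefZ coefX mulr0 subr0 szE.
rewrite /unit_poly sXE szE => /andP[_ /eqP sg].
rewrite /char_weight !twist_prod1 !lead_coefE sg sz //=.
rewrite !coefB !coefZ !coefX /= mulr1 gtn_eqF // mulr0 subr0.
by rewrite opprB thetaD mulrCA.
Qed.

Lemma unit_poly_sum_char_top n z : n.-primitive_root z ->
  exists C, forall X, mul_char X ->
  unit_poly_sum n (char_weight X n z) n =
  X (- (-1) ^+ n / n%:R) * (\sum_x X x * theta x) * C.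
Proof.
move=> zP; have n_gt0 := prim_order_gt0 zP.
have n0 : n%:R != 0 :> F := prim_root_natf_neq0 zP.
(* Writing [g] as [h + c T ^ n] with [h] of degree below [n], the character sees only [c]; the sum
   over [h] is the constant. *)
exists (\sum_(h : {poly_n F} | h`_0 == 1) theta (- (twist_prod n z h)`_n)) => X [XM X0 X1].
rewrite (bigD1 0) //= X0 mul0r add0r /unit_poly_sum.
transitivity (\sum_(c | c != 0) (X ((-1) ^+ n * c) * theta (- (n%:R * c)) *
   \sum_(h : {poly_n F} | h`_0 == 1) theta (- (twist_prod n z h)`_n))).
  under [RHS]eq_bigr do rewrite mulr_sumr.
  rewrite pair_big /=.
  have sX (h : {poly_n F}) (c : F) : (size (polyn h + c *: 'X^n : {poly F})%R <= n.+1)%N.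
    rewrite (leq_trans (size_polyD _ _)) // geq_max (leq_trans (size_npoly h)) //=.
    by rewrite (leq_trans (size_scale_leq _ _)) // size_polyXn.
  have KE (h : {poly_n F}) (c : F) :
      npolyp n.+1 (polyn h + c *: 'X^n) = polyn h + c *: 'X^n :> {poly F}.
    by rewrite npolypK.
  rewrite (reindex_onto (fun p : F * {poly_n F} => npolyp n.+1 (polyn p.2 + p.1 *: 'X^n))
     (fun g : {poly_n.+1 F} => (g`_n, npolyp n g))) /=; last first.
    move=> g _; apply/val_inj/polyP => i /=; rewrite KE coefD coef_npolyp coefZ coefXn.
    have [lt_in|lt_ni|->] := ltngtP i n; rewrite ?mulr0 ?addr0 ?mulr1 ?add0r //.
    by rewrite nth_default // (leq_trans (size_npoly _)).
  have hn (h : {poly_n F}) c : (polyn h + c *: 'X^n)`_n = c.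
    by rewrite coefD coefZ coefXn eqxx mulr1 nth_default ?size_npoly ?add0r.
  have h0 (h : {poly_n F}) c : (polyn h + c *: 'X^n)`_0 = h`_0.
    by rewrite coefD coefZ coefXn [0%N == n]ltn_eqF // mulr0 addr0.
  apply: eq_big => [[c h]|[c h]] /=.
    rewrite /unit_poly KE h0 hn; case: (h`_0 == 1); rewrite ?andbF //= andbT.
    have hK : npolyp n (polyn h + c *: 'X^n) = h.
      apply/val_inj/polyP => i /=; rewrite coef_npolyp coefD coefZ coefXn.
      case: ltngtP => [lt_in|lt_ni|->]; rewrite ?mulr0 ?addr0 // nth_default //.
        by rewrite (leq_trans (size_npoly h)) // ltnW.
      exact: size_npoly.
    rewrite hK eqxx andbT; have [->|cn0] := eqVneq c 0.
      by rewrite scale0r addr0 ltn_eqF // ltnS size_npoly.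
    rewrite eqn_leq sX ltnNge; apply/negP => /leq_sizeP/(_ n (leqnn _)).
    by rewrite hn => c0; rewrite c0 eqxx in cn0.
  rewrite /unit_poly KE h0 => /andP[/andP[/eqP hh0 /eqP sh] _].
  rewrite /char_weight lead_coefE sh /= hn coef_twist_prod_add ?size_npoly //.
  by rewrite opprD thetaD mulrA mulrAC.
rewrite -mulr_suml; congr (_ * _); rewrite mulr_sumr.
(* Replacing [c] by [- c / n] turns [theta (- (n c))] into [theta c]; this produces the argument of
   [X] in the statement. *)
have nV0 : - n%:R^-1 != 0 :> F by rewrite oppr_eq0 invr_eq0.
rewrite (reindex_inj (mulfI nV0)) /=.
apply: eq_big => [c|c _]; first by rewrite mulf_eq0 (negPf nV0).
have -> : n%:R * (- n%:R^-1 * c) = - c by rewrite mulNr mulrN mulVKf.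
rewrite opprK [RHS]mulrA -XM; congr (X _ * _).
by rewrite mulrA mulrN -mulNr.
Qed.

End CharWeight.

(** * Products recovered from logarithmic derivatives *)

Lemma coef_prod_lin (R : comNzRingType) m (g : 'I_m -> R) :
  (\prod_(l < m) (1 + g l *: 'X))`_m = \prod_(l < m) g l.
Proof.
suff [] : (\prod_(l < m) (1 + g l *: 'X))`_m = \prod_(l < m) g l /\
  (size (\prod_(l < m) (1 + g l *: 'X)%R)%R <= m.+1)%N by [].
elim: m g => [|m IH] g; first by rewrite !big_ord0 coef1 size_poly1.
rewrite !big_ord_recr /=; have [IHc IHs] := IH (fun l => g (widen_ord (leqnSn m) l)).
rewrite mulrDr mulr1 -scalerAr; split.
  by rewrite coefD coefZ coefMX /= IHc nth_default // add0r mulrC.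
rewrite (leq_trans (size_polyD _ _)) // geq_max (leq_trans IHs) //=.
rewrite (leq_trans (size_scale_leq _ _)) // (leq_trans (size_polyMleq _ _)) //.
by rewrite size_polyX addn2.
Qed.

(* A sequence is determined by its logarithmic derivative [S]: the hypotheses say
   that [E l] is the polynomial [1 + g l T] up to degree [n], and [W] is their
   product. *)
Lemma log_derivative_prod n (E S : 'I_n -> nat -> algC) (W : nat -> algC) :
  (forall l, E l 0 = 1) -> (forall l k, (1 < k <= n)%N -> E l k = 0) ->
  (forall l k, (k <= n)%N ->
     k%:R * E l k = \sum_(1 <= r < k.+1) S l r * E l (k - r)%N) ->
  W 0 = 1 ->
  (forall k, (k <= n)%N ->
     k%:R * W k = \sum_(1 <= r < k.+1) (\sum_l S l r) * W (k - r)%N) ->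
  W n = \prod_l E l 1.
Proof.
move=> E0 E2 ErecS W0 Wrec.
pose T l : {poly algC} := \poly_(r < n.+1) (if r == 0%N then 0 else S l r).
pose A l : {poly algC} := 1 + E l 1 *: 'X.
(* Congruence modulo [T ^ (n + 1)], in which the Leibniz rule below adds up logarithmic derivatives
   without any division. *)
pose cong (p q : {poly algC}) := forall i, (i <= n)%N -> p`_i = q`_i.
have congM p q c : cong p q -> cong (p * c) (q * c).
  move=> pq i le_in; rewrite !coefM; apply: eq_bigr => j _.
  by rewrite pq // (leq_trans _ le_in) // -ltnS.
have coefT (U : nat -> algC) (p : {poly algC}) k : (k <= n)%N ->
    (\poly_(r < n.+1) (if r == 0%N then 0 else U r) * p)`_k =
    \sum_(1 <= r < k.+1) U r * p`_(k - r).
  move=> le_kn; rewrite coefM big_add1 /= big_mkord big_ord_recl coef_poly /=.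
  rewrite mul0r add0r; apply: eq_bigr => r _.
  by rewrite coef_poly /bump /= add1n ltnS (leq_trans (ltn_ord r)).
have coefA l k : (k <= n)%N -> (A l)`_k = E l k.
  rewrite coefD coef1 coefZ coefX; case: k => [|[|k]] le_kn /=.
  - by rewrite mulr0 addr0 E0.
  - by rewrite add0r mulr1.
  - by rewrite [RHS]E2 // mulr0 addr0.
have XderivE (p : {poly algC}) k : ('X * p^`())`_k = k%:R * p`_k.
  rewrite coefXM coef_deriv; case: k => [|k] /=; first by rewrite mul0r.
  by rewrite mulr_natl.
have congA l : cong ('X * (A l)^`()) (T l * A l).
  move=> k le_kn; rewrite XderivE coefA // ErecS // coefT // !big_nat.
  by apply: eq_bigr => r /andP[_ lt_rk]; rewrite coefA // (leq_trans (leq_subr _ _)).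
have congP : forall s : seq 'I_n,
    cong ('X * (\prod_(l <- s) A l)^`()) ((\sum_(l <- s) T l) * \prod_(l <- s) A l).
  elim=> [|l s IH]; first by rewrite !big_nil derivC mulr0 mul0r.
  rewrite !big_cons derivM mulrDr [X in cong _ X]mulrDl => i le_in; rewrite !coefD.
  congr (_ + _).
    by rewrite !mulrA; apply: congM le_in; apply: congA.
  by rewrite ![A l * _]mulrC !mulrA; apply: congM le_in.
pose P := \prod_l A l.
(* [W] and the coefficients of [P] satisfy the same recurrence, and it determines them because a
   positive [k] is invertible in [algC]. *)
have WP k : (k <= n)%N -> W k = P`_k.
  elim/ltn_ind: k => -[|k] IH le_kn.
    rewrite W0 coef0_prod big1 // => l _.
    by rewrite coefA // E0.
  have k0 : k.+1%:R != 0 :> algC by rewrite Num.Theory.pnatr_eq0.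
  apply: (mulfI k0); rewrite Wrec // -XderivE congP //.
  have -> : \sum_l T l = \poly_(r < n.+1) (if r == 0%N then 0 else \sum_l S l r).
    apply/polyP => i; rewrite coef_sum coef_poly; case: ltnP => [lt_in|le_ni].
      case: eqP => [->|/eqP i0]; first by rewrite big1 // => l _; rewrite coef_poly.
      by apply: eq_bigr => l _; rewrite coef_poly lt_in (negPf i0).
    by rewrite big1 // => l _; rewrite coef_poly ltnNge le_ni.
  rewrite coefT // !big_nat; apply: eq_bigr => r /andP[r_gt0 _].
  have lt_r : (k.+1 - r < k.+1)%N by rewrite ltn_subrL r_gt0.
  by rewrite IH // ltnW // (leq_trans lt_r).
by rewrite WP // /P coef_prod_lin.
Qed.

(** * Frobenius sums of character weights *)

Section FrobSumChar.

Variables (F L : finFieldType) (iota : {rmorphism F -> L}).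
Local Notation phi := (frob iota).

(** On the field with q^r elements, this and [frob_trace] are the norm and trace down to [F], taken
    inside [L]. *)
Definition frob_norm r (x : L) := \prod_(i < r) iter i phi x.
Definition frob_trace r (x : L) := \sum_(i < r) iter i phi x.

Lemma map_twist_prod n z (g : {poly F}) :
  map_poly iota (twist_prod n z g) = twist_prod n (iota z) (map_poly iota g).
Proof.
rewrite /twist_prod rmorph_prod; apply: eq_bigr => l _ /=.
by rewrite map_comp_poly map_polyZ map_polyX rmorphXn.
Qed.

Lemma coef_twist_frob_poly n (z : L) r x : n.-primitive_root z ->
  (twist_prod n z (frob_poly iota r x))`_n = - frob_trace r (x ^+ n).
Proof.
move=> zP; have n_gt0 := prim_order_gt0 zP; rewrite /frob_trace -sumrN.
suff [] : (frob_poly iota r x)`_0 = 1 /\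
  (twist_prod n z (frob_poly iota r x))`_n = \sum_(i < r) - iter i phi (x ^+ n) by [].
elim: r => [|r [IH0 IHn]].
  rewrite /frob_poly !big_ord0; split; first by rewrite coef1.
  rewrite /twist_prod big1 => [|l _]; first by rewrite coef1 gtn_eqF.
  by rewrite -[1]/(1%:P) comp_polyC.
have lin0 : (1 - iter r phi x *: 'X)`_0 = 1.
  by rewrite coefB coef1 coefZ coefX mulr0 subr0.
rewrite -addn1 frob_polyD /(frob_poly _ 1 _) big_ord1 /= coef0M IH0 lin0 mulr1.
split=> //; rewrite coef_twist_prodM // IHn coef_twist_prod_lin //.
by rewrite addn1 big_ord_recr /= !iter_frob exprAC.
Qed.

Lemma frob_norm_base r x : x != 0 -> iter r phi x = x ->
  iota ((-1) ^+ r * lead_coef (base_frob_poly iota r x)) = frob_norm r x.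
Proof.
move=> x0 fx; rewrite rmorphM rmorphXn rmorphN1 /= -lead_coef_map base_frob_polyK //.
rewrite /frob_poly lead_coef_prod -[r in _ ^+ r]card_ord -prodr_const -big_split.
apply: eq_bigr => i _ /=; rewrite lead_coefE.
have ix : iter i phi x != 0 by rewrite iter_frob expf_neq0.
rewrite (eqp_size (oneBscaleX_eqp ix)) size_XsubC /= coefB coef1 coefZ coefX.
by rewrite sub0r mulr1 mulN1r opprK.
Qed.

(** This exhibits [frob_sum] as a Gauss-type sum whose characters are composed with the norm and the
    trace. *)
Lemma char_weight_frob theta X n z r x : n.-primitive_root z ->
  x != 0 -> iter r phi x = x ->
  char_weight theta X n z (base_frob_poly iota r x) =
  X (unfrob iota (frob_norm r x)) * theta (unfrob iota (frob_trace r (x ^+ n))).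
Proof.
move=> zP x0 fx; have [_ /eqP sb] := andP (base_frob_polyP x0 fx).
rewrite /char_weight sb /= -frob_norm_base // unfrobK; congr (_ * theta _).
rewrite -[LHS](unfrobK iota) rmorphN /= -coef_map map_twist_prod base_frob_polyK //.
by rewrite coef_twist_frob_poly ?fmorph_primitive_root // opprK.
Qed.

Lemma frob_normX r x n : frob_norm r (x ^+ n) = frob_norm r x ^+ n.
Proof.
by rewrite /frob_norm -prodrXl; apply: eq_bigr => i _; rewrite !iter_frob exprAC.
Qed.

Lemma frob_normE r x : frob_norm r x = x ^+ (\sum_(i < r) #|F| ^ i)%N.
Proof.
by rewrite /frob_norm expr_sum; apply: eq_bigr => i _; rewrite iter_frob.
Qed.

Lemma frob_norm_unfrob r x : x != 0 -> iter r phi x = x ->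
  iota (unfrob iota (frob_norm r x)) = frob_norm r x.
Proof. by move=> x0 fx; rewrite -frob_norm_base // unfrobK. Qed.

Variable N : nat.
Hypothesis split_iota : forall g : {poly F}, g != 0 -> (size g <= N)%N ->
  exists rs, map_poly iota g %= \prod_(r <- rs) ('X - r%:P).

Variables (theta X h : F -> algC) (n : nat) (zeta : F).
Hypotheses (zetaP : n.-primitive_root zeta).
Hypothesis XP : mul_char X.
Hypothesis h_order : forall x, x != 0 -> h x ^+ n = 1.
Hypothesis h_ker : forall x, x != 0 ->
  (h x == 1) = (x ^+ (#|F|.-1 %/ n) == 1).

Lemma char_sum_powers x : x != 0 ->
  \sum_(l < n) h x ^+ l = (if x ^+ (#|F|.-1 %/ n) == 1 then n%:R else 0).
Proof.
move=> x0; rewrite -h_ker //; case: eqP => [->|/eqP hx1].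
  rewrite (eq_bigr (fun _ => 1)) => [|l _]; last by rewrite expr1n.
  by rewrite sumr_const card_ord.
have := subrX1 (h x) n; rewrite h_order // subrr => /esym/eqP.
by rewrite mulf_eq0 subr_eq0 (negPf hx1) => /eqP.
Qed.

(** The substitution [t = x ^+ n] weights [t] by its number of n-th roots, which is the sum over [l]
    of [h ^+ l] at the norm of [t]. *)
Lemma frob_sum_power_char r : (0 < r)%N -> (#|F| ^ r <= N)%N ->
  frob_sum iota (char_weight theta (fun x => X x ^+ n) n zeta) r =
  \sum_(l < n) frob_sum iota (char_weight theta (fun x => X x * h x ^+ l) 1 1) r.
Proof.
move=> r_gt0 le_rN; have [XM X0 X1] := XP.
pose f t := X (unfrob iota (frob_norm r t)) * theta (unfrob iota (frob_trace r t)).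
transitivity (\sum_(x : L | (x != 0) && (iter r phi x == x)) f (x ^+ n)).
  apply: eq_bigr => x /andP[x0 /eqP fx]; rewrite char_weight_frob //.
  rewrite /f frob_normX -(frob_norm_unfrob x0 fx) -rmorphXn /= !unfrobK.
  congr (_ * _); elim: (n) => [|m IH]; first by rewrite X1.
  by rewrite !exprS XM IH.
rewrite (nth_power_sum split_iota zetaP r_gt0 le_rN) /frob_sum exchange_big /=.
apply: eq_bigr => t /andP[t0 /eqP ft].
have tP1 : 1.-primitive_root (1 : F).
  by apply/andP; split=> //; apply/forallP => i; rewrite ord1 unity_rootE expr1 !eqxx.
under [RHS]eq_bigr => l _ do rewrite char_weight_frob // expr1 mulrAC.
rewrite -mulr_sumr [RHS]mulrC; congr (_ * _).
set a := unfrob _ _; have def_a : iota a = frob_norm r t by rewrite frob_norm_unfrob.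
have a0 : a != 0.
  by rewrite -(fmorph_eq0 iota) def_a frob_normE expf_neq0.
(* The norm is the power of exponent [(q^r - 1) / (q - 1)], so [t] and its norm meet the same n-th
   power criterion. *)
rewrite char_sum_powers // -(fmorph_eq1 iota) rmorphXn /= def_a frob_normE -exprM.
by rewrite muln_divA ?(prim_root_dvd_card zetaP) // mulnC -predn_exp.
Qed.

End FrobSumChar.

(** * The Hasse-Davenport product formula *)

Section HasseDavenport.

Variables (F : finFieldType) (theta : F -> algC).
Hypotheses (thetaP : add_char theta) (theta_nt : exists s, theta s != 1).

Definition char_sum (X : F -> algC) := \sum_x X x * theta x.

(** The last clause makes the kernel of [h] the group of n-th powers when [n] divides [q - 1], so
    that [h] has order exactly [n]. *)
Definition power_residue_char n (h : F -> algC) :=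
  [/\ mul_char h, forall x, x != 0 -> h x ^+ n = 1 &
   forall x, x != 0 -> (h x == 1) = (x ^+ (#|F|.-1 %/ n) == 1)].

Lemma hasse_davenport_product n (zeta : F) : n.-primitive_root zeta ->
  exists C, forall X h, mul_char X -> power_residue_char n h ->
  \prod_(l < n) char_sum (fun x => X x * h x ^+ l) =
  X (- (-1) ^+ n / n%:R) ^+ n * char_sum (fun x => X x ^+ n) * C.
Proof.
move=> zP; have n_gt0 := prim_order_gt0 zP.
have [C CP] := unit_poly_sum_char_top thetaP zP.
exists C => X h XP [hP h_n h_ker]; have [XM X0 X1] := XP; have [hM h0 h1] := hP.
have XnP : mul_char (fun x => X x ^+ n).
  by split=> [x y||]; rewrite ?X0 ?X1 ?expr1n ?expr0n ?gtn_eqF // XM exprMn.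
(* For [l = 0] the power [h 0 ^+ l] is 1, so the vanishing at 0 comes from [X]. *)
have XhP l : mul_char (fun x => X x * h x ^+ l).
  split=> [x y||]; first by rewrite XM hM exprMn mulrACA.
    by rewrite X0 mul0r.
  by rewrite X1 h1 expr1n mulr1.
rewrite -(CP _ XnP).
(* The size [q ^ n] covers the polynomials of degree at most [n] as well as [X^(q^r - 1) - 1] for
   [r <= n]. *)
have [L [iota splitL]] := splitting_extension F (#|F| ^ n)%N.
have q_gt1 : (1 < #|F|)%N := finNzRing_gt1 F.
have splitn (g : {poly F}) : g != 0 -> (size g <= n.+1)%N ->
    exists rs, map_poly iota g %= \prod_(r <- rs) ('X - r%:P).
  by move=> g0 sg; apply: splitL; rewrite // (leq_trans sg) // ltn_expl.
have P1 : 1.-primitive_root (1 : F).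
  by apply/andP; split=> //; apply/forallP => i; rewrite ord1 unity_rootE expr1 !eqxx.
pose w l := char_weight theta (fun x => X x * h x ^+ l) 1 1.
pose E (l : 'I_n) k : algC := unit_poly_sum n (w l) k.
pose S (l : 'I_n) r : algC := frob_sum iota (w l) r.
rewrite (eq_bigr (fun l => E l 1%N)) => [|l _]; last first.
  by rewrite /E unit_poly_sum_char1.
apply/esym; apply: (log_derivative_prod (S := S)) => [l|l k|l k le_kn||k le_kn].
- by rewrite /E /w unit_poly_sum_char0.
- by move=> lek; rewrite /E /w unit_poly_sum_char_gt1.
- by apply: unit_poly_sum_rec => //; apply: char_weightM.
- by rewrite unit_poly_sum_char0.
rewrite (unit_poly_sum_rec splitn _ le_kn); last exact: char_weightM.
rewrite !big_nat; apply: eq_bigr => r /andP[r_gt0 lt_rk]; congr (_ * _).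
rewrite (frob_sum_power_char splitL _ zP XP h_n h_ker) //.
by rewrite leq_exp2l // (leq_trans _ le_kn).
Qed.

Let thetaD : {morph theta : x y / x + y >-> x * y} := proj1 thetaP.
Let theta0 : theta 0 = 1 := proj2 thetaP.

Lemma add_char_sum c : \sum_a theta (a * c) = (if c == 0 then #|F|%:R else 0).
Proof.
case: eqP => [->|/eqP c0].
  rewrite (eq_bigr (fun _ => 1)) => [|a _]; last by rewrite mulr0.
  by rewrite sumr_const.
have -> : \sum_a theta (a * c) = \sum_a theta a by rewrite [RHS](reindex_inj (mulIf c0)).
have [s ths1] := theta_nt.
have /eqP : \sum_a theta a = theta s * \sum_a theta a.
  rewrite mulr_sumr [LHS](reindex_inj (addrI s)).
  by apply: eq_bigr => a _; rewrite thetaD.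
rewrite -[X in X == _]mul1r -subr_eq0 -mulrBl mulf_eq0 subr_eq0 eq_sym (negPf ths1).
by move/eqP.
Qed.

(** Nonvanishing lets the constant [C] cancel in quotients. A trivial [X] gives -1, and for the
    others Fourier inversion rules out 0. *)
Lemma char_sum_neq0 X : mul_char X -> char_sum X != 0.
Proof.
move=> [XM X0 X1].
have q0 : #|F|%:R != 0 :> algC.
  by rewrite Num.Theory.pnatr_eq0 -lt0n ltnW ?finNzRing_gt1.
case: (boolP [forall x, (x != 0) ==> (X x == 1)]) => [/forallP X_triv|].
  suff -> : char_sum X = - 1 by rewrite oppr_eq0 oner_eq0.
  have := add_char_sum 1; rewrite oner_eq0 => sum0.
  rewrite -[-1]add0r -{1}sum0 [in RHS](bigD1 0) //= mul0r theta0 addrAC subrr add0r.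
  rewrite /char_sum (bigD1 0) //= X0 mul0r add0r; apply: eq_bigr => x x0.
  by have /implyP/(_ x0)/eqP-> := X_triv x; rewrite mul1r mulr1.
rewrite negb_forall => /existsP[y]; rewrite negb_imply => /andP[y0 Xy].
have sumX0 : \sum_x X x = 0.
  have /eqP : \sum_x X x = X y * \sum_x X x.
    rewrite mulr_sumr [LHS](reindex_inj (mulfI y0)).
    by apply: eq_bigr => a _; rewrite XM.
  rewrite -[X in X == _]mul1r -subr_eq0 -mulrBl mulf_eq0 subr_eq0 eq_sym (negPf Xy).
  by move/eqP.
apply: contraNneq q0 => s0.
(* Fourier inversion at [1] of [X], whose transform at [a] is [X a^-1] times the
   Gauss sum. *)
have <- : \sum_a theta (- a) * \sum_x X x * theta (a * x) = #|F|%:R.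
  under eq_bigr do rewrite mulr_sumr.
  rewrite exchange_big /= (bigD1 1) //= X1.
  rewrite [X in X + _](eq_bigr (fun _ => 1)) => [|a _]; last first.
    by rewrite mul1r mulr1 -thetaD addNr.
  rewrite sumr_const big1 ?addr0 // => x x1.
  transitivity (X x * \sum_a theta (a * (x - 1))).
    rewrite mulr_sumr; apply: eq_bigr => a _.
    by rewrite mulrCA -thetaD mulrBr mulr1 addrC.
  by rewrite add_char_sum subr_eq0 (negPf x1) mulr0.
apply/eqP; apply: big1 => a _; have [->|a0] := eqVneq a 0.
  under eq_bigr do rewrite mul0r theta0 mulr1.
  by rewrite sumX0 mulr0.
rewrite (reindex_inj (mulfI (_ : a^-1 != 0))) ?invr_eq0 //=.
under eq_bigr do rewrite XM mulVKf // -mulrA.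
by rewrite -mulr_sumr -/(char_sum X) s0 !mulr0.
Qed.

(** Numerator and denominator carry the same [C], and [C = 0] would make the denominator vanish. *)
Lemma hasse_davenport_ratio n (zeta : F) X Y h : n.-primitive_root zeta ->
  mul_char X -> mul_char Y -> power_residue_char n h ->
  \prod_(l < n) (char_sum (fun x => X x * Y x * h x ^+ l) /
                 char_sum (fun x => X x * h x ^+ l)) =
  Y (- (-1) ^+ n / n%:R) ^+ n *
  (char_sum (fun x => (X x * Y x) ^+ n) / char_sum (fun x => X x ^+ n)).
Proof.
move=> zP XP YP hP; have [C HD] := hasse_davenport_product zP.
have n_gt0 := prim_order_gt0 zP.
have n0 : n%:R != 0 :> F := prim_root_natf_neq0 zP.
have [XM X0 X1] := XP; have [YM Y0 Y1] := YP; have [[hM h0 h1] _ _] := hP.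
have XYP : mul_char (fun x => X x * Y x).
  by split=> [x y||]; rewrite ?X0 ?X1 ?Y1 ?mul0r ?mulr1 // XM YM mulrACA.
have XhP l : mul_char (fun x => X x * h x ^+ l).
  split=> [x y||]; first by rewrite XM hM exprMn mulrACA.
    by rewrite X0 mul0r.
  by rewrite X1 h1 expr1n mulr1.
have nz : \prod_(l < n) char_sum (fun x => X x * h x ^+ l) != 0.
  by apply/prodf_neq0 => l _; apply: char_sum_neq0.
rewrite prodf_div HD // HD // in nz *.
move: nz; rewrite !mulf_eq0 !negb_or => /andP[/andP[XD XS] C0].
rewrite exprMn -mulf_div divff // mulr1 -mulf_div; congr (_ * _).
by rewrite [_ * Y _ ^+ n]mulrC mulfK.
Qed.

End HasseDavenport.

(** * Multiplicative characters as class functions *)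

Section CharExt.

Variable F : finFieldType.
Implicit Types (chi psi : mulCF F) (u : {unit F}).

Lemma char_ext_unit chi u : char_ext chi (val u) = chi u.
Proof. by rewrite /char_ext valK. Qed.

Lemma char_ext0 chi : char_ext chi 0 = 0.
Proof. by rewrite /char_ext insubF // unitr0. Qed.

Variant unit_spec : F -> Type :=
  | UnitSpec0 : unit_spec 0
  | UnitSpec u : unit_spec (val u).

Lemma unitP x : unit_spec x.
Proof.
have [->|x0] := eqVneq x 0; first by constructor.
by rewrite -[x]/(val (finField_unit x0)); constructor.
Qed.

Lemma val_unit_neq0 u : val u != 0.
Proof. by rewrite -unitfE; apply: valP. Qed.

Lemma char_extM chi psi x : char_ext (chi * psi) x = char_ext chi x * char_ext psi x.
Proof.
by case: (unitP x) => [|u]; rewrite ?char_ext0 ?mul0r // !char_ext_unit cfunE.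
Qed.

(** The condition on [x] is there for [k = 0]: at 0 the left side would be 0 and the right side
    1. *)
Lemma char_extX chi k x : x != 0 -> char_ext (chi ^+ k) x = char_ext chi x ^+ k.
Proof.
case: (unitP x) => [|u _]; first by rewrite eqxx.
by rewrite !char_ext_unit; elim: k => [|k IH]; rewrite ?cfun1E ?inE // !exprS cfunE IH.
Qed.

Lemma char_extV chi x : chi \is a linear_char ->
  char_ext chi^-1 x = (char_ext chi x)^-1.
Proof.
move=> chiL; case: (unitP x) => [|u]; rewrite ?char_ext0 ?invr0 // !char_ext_unit.
have /cfunP/(_ u) := mulVr (lin_char_unitr chiL).
rewrite cfunE cfun1E inE => E; rewrite -[RHS]mul1r -[1]E mulfK //.
by rewrite lin_char_neq0 ?inE.
Qed.

Lemma mul_char_ext chi : chi \is a linear_char -> mul_char (char_ext chi).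
Proof.
move=> chiL; split=> [x y||]; last 2 first.
- exact: char_ext0.
- by rewrite -[1]/(val (1%g : {unit F})) char_ext_unit lin_char1.
case: (unitP x) => [|u]; first by rewrite mul0r char_ext0 mul0r.
case: (unitP y) => [|v]; first by rewrite mulr0 char_ext0 mulr0.
by rewrite -[_ * _]/(val (u * v)%g) !char_ext_unit lin_charM ?inE.
Qed.

Lemma add_char_lin (theta : addCF F) : theta \is a linear_char -> add_char theta.
Proof.
move=> thL; split=> [x y|]; last exact: lin_char1.
by rewrite -lin_charM ?inE.
Qed.

(** At a generator [g] of the unit group, [chi g] has order exactly [n], so for [u = g ^+ a] both
    kernel conditions say that [n] divides [a]. *)
Lemma power_residue_char_ext n chi : (0 < n)%N -> chi \is a linear_char ->
  #[chi]%CF = n -> (n %| #|F|.-1)%N -> power_residue_char n (char_ext chi).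
Proof.
move=> n_gt0 chiL chin dvn; have chi_n u : chi u ^+ n = 1.
  rewrite -char_ext_unit -char_extX ?val_unit_neq0 // -chin exp_cforder.
  by rewrite char_ext_unit cfun1E inE.
split; first exact: mul_char_ext.
  by move=> x; case: (unitP x) => [|u _]; rewrite ?eqxx // char_ext_unit.
move=> x; case: (unitP x) => [|u _]; rewrite ?eqxx // char_ext_unit.
have /cyclicP[g defU] : cyclic [set: {unit F}] := field_unit_group_cyclic _.
have og : #[g]%g = #|F|.-1 by rewrite orderE -defU card_finField_unit.
have /cycleP[a ->] : u \in <[g]>%g by rewrite -defU inE.
rewrite -FinRing.val_unitX -FinRing.val_unit1 val_eqE -expgM -order_dvdn og lin_charX ?inE //.
have d_gt0 : (0 < #|F|.-1 %/ n)%N.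
  by rewrite divn_gt0 // dvdn_leq // -og order_gt0.
rewrite -{1}(divnK dvn) [(_ * n)%N]mulnC dvdn_pmul2r //.
apply/eqP/idP => [chia|/dvdnP[b ->]]; last by rewrite mulnC exprM chi_n expr1n.
rewrite -chin dvdn_cforder; apply/eqP/cfunP => v.
rewrite -char_ext_unit char_extX ?val_unit_neq0 // char_ext_unit cfun1E inE.
have /cycleP[b ->] : v \in <[g]>%g by rewrite -defU inE.
by rewrite lin_charX ?inE // exprAC chia expr1n.
Qed.

Lemma lin_Iirr (j : Iirr [set: {unit F}]) : 'chi_j \is a linear_char.
Proof. by apply: irr_cyclic_lin; apply: field_unit_group_cyclic. Qed.

Lemma sum_irr_unit u : \sum_(j : Iirr [set: {unit F}]) 'chi_j u = #|F|.-1%:R *+ (u == 1%g).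
Proof.
rewrite -card_finField_unit -cfRegE cfReg_sum sum_cfunE; apply: eq_bigr => j _.
by rewrite cfunE lin_char1 ?mul1r // lin_Iirr.
Qed.

(* Both sides count, weighted by [H], the pairs of a character and one of its
   [n]-th roots, the number of which is given by orthogonality. *)
Lemma sum_irr_power n (zeta : F) (H : mulCF F -> algC) : n.-primitive_root zeta ->
  \sum_(j : Iirr [set: {unit F}]) H ('chi_j ^+ n) =
  \sum_(j : Iirr [set: {unit F}]) H 'chi_j * \sum_(l < n) char_ext 'chi_j (zeta ^+ l).
Proof.
move=> zP; have n_gt0 := prim_order_gt0 zP; have z0 := prim_root_neq0 zP.
pose z : {unit F} := finField_unit z0.
have U0 : #|[set: {unit F}]|%:R != 0 :> algC.
  by rewrite Num.Theory.pnatr_eq0 -lt0n cardG_gt0.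
transitivity (\sum_(k : Iirr [set: {unit F}]) H 'chi_k *
   \sum_(j : Iirr [set: {unit F}]) '['chi_j ^+ n, 'chi_k]).
  under [RHS]eq_bigr do rewrite mulr_sumr.
  rewrite exchange_big; apply: eq_bigr => j _ /=.
  have /irrP[i ->] : 'chi_j ^+ n \in irr [set: {unit F}].
    by rewrite lin_char_irr // rpredX // lin_Iirr.
  rewrite (bigD1 i) //= cfdot_irr eqxx mulr1 big1 ?addr0 // => k ki.
  by rewrite cfdot_irr eq_sym (negPf ki) mulr0.
apply: eq_bigr => k _; congr (_ * _).
under eq_bigr do rewrite cfdotE.
rewrite -mulr_sumr exchange_big /=.
(* Orthogonality in [j] leaves only the [u] with [u ^+ n = 1], which are the powers of [zeta]. *)
transitivity (#|[set: {unit F}]|%:R^-1 * \sum_(u in [set: {unit F}])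
    (#|[set: {unit F}]|%:R *+ (u ^+ n == 1)%g * 'chi_k u^-1%g)).
  congr (_ * _); apply: eq_bigr => u _; rewrite -mulr_suml lin_charV_conj ?lin_Iirr //.
  congr (_ * _); rewrite card_finField_unit -sum_irr_unit; apply: eq_bigr => j _.
  by rewrite lin_charX ?inE ?lin_Iirr // -!char_ext_unit char_extX // val_unit_neq0.
rewrite mulr_sumr (reindex_inj invg_inj) /=.
transitivity (\sum_(u in [set: {unit F}] | (u ^+ n == 1)%g) 'chi_k u).
  rewrite [RHS]big_mkcondr; apply: eq_big => u; rewrite ?inE // => _.
  rewrite invgK expgVn (inv_eq invgK) invg1.
  by case: eqP => _; rewrite ?mulr1n ?mulr0n ?mul0r ?mulr0 // mulKf.
transitivity (\sum_(l < n) 'chi_k (z ^+ l)%g); last first.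
  by apply: eq_bigr => l _; rewrite -char_ext_unit FinRing.val_unitX.
have vz l : val (z ^+ l)%g = zeta ^+ l by rewrite FinRing.val_unitX.
rewrite -(big_imset (h := fun l : 'I_n => (z ^+ l)%g) (A := 'I_n)) /=; last first.
  move=> l1 l2 _ _ /(congr1 val)/eqP; rewrite !vz (eq_prim_root_expr zP).
  by rewrite !modn_small // => /eqP/val_inj.
apply: eq_bigl => u; rewrite inE /=; apply/eqP/imsetP => [un|[l _ ->]].
  have /(prim_rootP zP)[l ul] : val u ^+ n = 1 by rewrite -FinRing.val_unitX un.
  by exists l => //; apply/val_inj; rewrite vz.
by apply/val_inj; rewrite FinRing.val_unitX vz exprAC (prim_expr_order zP) expr1n.
Qed.

End CharExt.

(** * Quotients of Gauss sums *)

Section GaussSumRatio.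

Variables (F : finFieldType) (theta : addCF F).
Hypotheses (thetaL : theta \is a linear_char) (theta1 : theta != 1).
Variables (n : nat) (zeta : F).
Hypothesis zetaP : n.-primitive_root zeta.

Local Notation D := (- (-1) ^+ n / n%:R : F).

Let n_gt0 : (0 < n)%N := prim_order_gt0 zetaP.

Lemma gauss_sum_ratio (A chi eta : mulCF F) :
  A \is a linear_char -> chi \is a linear_char -> eta \is a linear_char ->
  power_residue_char n (char_ext eta) ->
  \prod_(l < n) (gauss_sum theta (A * eta ^+ l * chi) /
                 gauss_sum theta (A * eta ^+ l)) =
  char_ext chi D ^+ n *
  (gauss_sum theta (A ^+ n * chi ^+ n) / gauss_sum theta (A ^+ n)).
Proof.
move=> AL chiL etaL etaP.
have theta_nt : exists s, theta s != 1.
  apply/existsP; apply: contraR theta1; rewrite negb_exists => /forallP th1.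
  by apply/eqP/cfunP => s; rewrite cfun1E inE; apply/eqP; rewrite -[_ == _]negbK th1.
(* Pointwise powers agree with the extended characters away from 0; at 0 both must vanish, which for
   n-th powers uses [n > 0]. *)
have eq_gs (X : F -> algC) (psi : mulCF F) : (forall x, x != 0 -> X x = char_ext psi x) ->
    X 0 = 0 -> gauss_sum theta psi = char_sum theta X.
  move=> eqX X0; apply: eq_bigr => x _; have [->|x0] := eqVneq x 0.
    by rewrite char_ext0 X0.
  by rewrite eqX.
have ratio := hasse_davenport_ratio (add_char_lin thetaL) theta_nt zetaP
  (mul_char_ext AL) (mul_char_ext chiL) etaP.
rewrite (eq_gs (fun x => (char_ext A x * char_ext chi x) ^+ n)); first last.
- by rewrite !char_ext0 mul0r expr0n gtn_eqF.
- by move=> x x0; rewrite char_extM !char_extX // exprMn.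
rewrite (eq_gs (fun x => char_ext A x ^+ n)); first last.
- by rewrite !char_ext0 expr0n gtn_eqF.
- by move=> x x0; rewrite char_extX.
rewrite -ratio; apply: eq_bigr => l _; congr (_ / _); apply: eq_gs.
- by move=> x x0; rewrite !char_extM char_extX // mulrAC.
- by rewrite !char_ext0 !mul0r.
- by move=> x x0; rewrite !char_extM char_extX.
- by rewrite !char_ext0 !mul0r.
Qed.

(** The upper parameters produce the n-th power of [chi] at [D]. The lower ones, treated through the
    inverses of [B], [chi] and [eta], produce its inverse. *)
Lemma hyp_factor_ratio (A B chi eta : mulCF F) :
  A \is a linear_char -> B \is a linear_char -> chi \is a linear_char ->
  eta \is a linear_char -> power_residue_char n (char_ext eta) ->
  \prod_(l < n)
    (gauss_sum theta (A * eta ^+ l * chi) / gauss_sum theta (A * eta ^+ l) *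
     (gauss_sum theta (B * eta ^+ l * chi)^-1 / gauss_sum theta (B * eta ^+ l)^-1)) =
  gauss_sum theta (A ^+ n * chi ^+ n) / gauss_sum theta (A ^+ n) *
  (gauss_sum theta (B ^+ n * chi ^+ n)^-1 / gauss_sum theta (B ^+ n)^-1).
Proof.
move=> AL BL chiL etaL etaP; rewrite big_split /= gauss_sum_ratio //.
have etaVP : power_residue_char n (char_ext eta^-1).
  have [_ eta_n eta_ker] := etaP; split; first by apply: mul_char_ext; rewrite rpredV.
    by move=> x x0; rewrite char_extV // exprVn eta_n // invr1.
  by move=> x x0; rewrite char_extV // invr_eq1 eta_ker.
have VM (phi psi : mulCF F) : phi \is a linear_char -> psi \is a linear_char ->
    (phi * psi)^-1 = phi^-1 * psi^-1.
  by move=> phiL psiL; rewrite invrM ?lin_char_unitr // mulrC.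
have := gauss_sum_ratio (A := B^-1) (chi := chi^-1) (eta := eta^-1).
rewrite !rpredV // => /(_ BL chiL etaL etaVP) ratioV.
under [X in _ * X = _]eq_bigr => l _.
  rewrite !VM ?rpredM ?rpredX // -!exprVn.
over.
rewrite ratioV VM ?rpredX // -!exprVn char_extV // mulrACA -exprMn divff ?expr1n ?mul1r //.
have n0 : n%:R != 0 :> F := prim_root_natf_neq0 zetaP.
have D0 : D != 0 by rewrite mulf_neq0 ?invr_eq0 // oppr_eq0 signr_eq0.
by rewrite -[D]/(val (finField_unit D0)) char_ext_unit lin_char_neq0 ?inE.
Qed.

End GaussSumRatio.

(** * Summation over the arguments [zeta ^+ l * lambda] *)

Theorem theorem2p1 (F : finFieldType)
  (theta : addCF F) (htheta : theta \is a linear_char) (htheta1 : theta != 1)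
  (n : nat) (hn : (0 < n)%N) (hq : (#|F| = 1 %[mod n])%N)
  (zeta : F) (hzeta : n.-primitive_root zeta)
  (chi_n : mulCF F) (hchi : chi_n \is a linear_char)
  (hchi_n : #[chi_n]%CF = n)
  (m : nat) (hm : (0 < m)%N)
  (A B : 'I_m -> mulCF F)
  (hA : forall i, A i \is a linear_char)
  (hB : forall i, B i \is a linear_char)
  (lambda : F) :
  \sum_(l < n)
     hypF theta (fun i => A i ^+ n) (fun i => B i ^+ n) (zeta ^+ l * lambda) =
  hypF theta (fun p : 'I_m * 'I_n => A p.1 * chi_n ^+ p.2)
             (fun p : 'I_m * 'I_n => B p.1 * chi_n ^+ p.2) (lambda ^+ n).
Proof.
have chi_nP : power_residue_char n (char_ext chi_n).
  by apply: power_residue_char_ext => //; apply: prim_root_dvd_card hzeta.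
(* [H] is the summand of the left-hand side at [lambda]. The twists weight it by the sum over [l] of
   the values at [zeta ^+ l], while the right-hand side evaluates it at n-th powers of
   characters. *)
pose H (psi : mulCF F) :=
  \prod_(i < m) (gauss_sum theta (A i ^+ n * psi) / gauss_sum theta (A i ^+ n) *
     (gauss_sum theta (B i ^+ n * psi)^-1 / gauss_sum theta (B i ^+ n)^-1)) *
  char_ext psi (-1) ^+ m * char_ext psi lambda.
rewrite /hypF -mulr_sumr; congr (_ * _).
transitivity (\sum_(j : Iirr [set: {unit F}]) H ('chi_j ^+ n)).
  rewrite (sum_irr_power _ hzeta) exchange_big /=.
  apply: eq_big => j; first by rewrite lin_Iirr.
  move=> jL; have [chiM _ _] := mul_char_ext jL.
  rewrite mulr_sumr; apply: eq_bigr => l _.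
  by rewrite chiM card_ord [RHS]mulrC mulrCA.
apply: eq_big => j; first by rewrite lin_Iirr.
move=> _.
have jL := lin_Iirr j; have [chiM chi0 chi1] := mul_char_ext jL.
have chiX x k : char_ext 'chi_j (x ^+ k) = char_ext 'chi_j x ^+ k.
  by elim: k => [|k IH]; rewrite ?expr0 // !exprS chiM IH.
have extX x : char_ext ('chi_j ^+ n) x = char_ext 'chi_j x ^+ n.
  have [->|x0] := eqVneq x 0; last exact: char_extX.
  by rewrite !char_ext0 expr0n gtn_eqF.
rewrite /H !extX chiX card_prod !card_ord mulnC exprM; congr (_ * _ * _).
under [LHS]eq_bigr => i _ do
  rewrite -(hyp_factor_ratio htheta htheta1 hzeta (hA i) (hB i) jL hchi chi_nP).
by rewrite pair_bigA.
Qed.
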